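(* Let $n\ge 2$ and let $G$ be a connected $\mathcal{C}_n$-symmetric graph. Then $G$ has a $\mathcal{C}_n$-symmetric NAC-colouring if and only if $G$ has a $\mathcal{C}_n$-symmetric flexible placement in $\mathbb{R}^2$, i.e. there exists a placement $p$ of $G$ in $\mathbb{R}^2$ such that $(G,p)$ is a $\mathcal{C}_n$-symmetric framework that is $\mathcal{C}_n$-symmetric flexible.
   Context: All graphs are finite and simple. Symmetric graphs. Let $n\ge 2$ and let $\mathcal{C}_n=\langle \omega : \omega^n=1\rangle$ be the cyclic group of order $n$. It acts on a graph $G$ via an injective group homomorphism $\theta:\mathcal{C}_n\to \operatorname{Aut}(G)$; write $\gamma v:=\theta(\gamma)(v)$ for $v\in V(G)$ and $\gamma e:=\gamma u\,\gamma v$ for $e=uv\in E(G)$. A vertex $v$ is invariant if $\gamma v=v$ for all $\gamma\in\mathcal{C}_n$, and partially invariant if $\gamma v=v$ for some $\gamma\in\mathcal{C}_n$, $\gamma\ne 1$. The graph $G$ (with this action) is $\mathcal{C}_n$-symmetric if every partially invariant vertex is invariant and the set of invariant vertices is an independent set of $G$. Frameworks. A placement of $G$ is a (possibly non-injective) map $p:V(G)\to\mathbb{R}^2$ with $p(u)\neq p(v)$ whenever $uv\in E(G)$; the pair $(G,p)$ is a framework. Frameworks $(G,p)$ and $(G,q)$ are equivalent if $\|p(u)-p(v)\|=\|q(u)-q(v)\|$ for all $uv\in E(G)$; placements $p,q$ are congruent if this equality holds for all $u,v\in V(G)$. A flex of $(G,p)$ is a continuous path $t\mapsto p_t$, $t\in[0,1]$,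 in the space of placements of $G$ with $p_0=p$ and each $(G,p_t)$ equivalent to $(G,p)$; it is trivial if $p_t$ is congruent to $p$ for all $t\in[0,1]$. For a $\mathcal{C}_n$-symmetric graph $G$, a placement $p$ is $\mathcal{C}_n$-symmetric if $p(\gamma v)=\tau(\gamma)p(v)$ for all $v\in V(G)$ and $\gamma=\omega^k\in\mathcal{C}_n$, where $\tau(\omega^k)$ is the rotation matrix by angle $2k\pi/n$; then $(G,p)$ is a $\mathcal{C}_n$-symmetric framework. A $\mathcal{C}_n$-symmetric framework $(G,p)$ is $\mathcal{C}_n$-symmetric flexible if it has a non-trivial flex $p_t$ such that each $(G,p_t)$ is $\mathcal{C}_n$-symmetric. Colourings. A NAC-colouring of $G$ is a map $\delta:E(G)\to\{\text{red},\text{blue}\}$ (incident edges may have the same colour) that is surjective and such that for each cycle of $G$ either all edges have the same colour or there are at least two red and at least two blue edges. A red component is a connected component of the graph $(V(G),\{e\in E(G):\delta(e)=\text{red}\})$ (isolated vertices included); blue components are defined analogously. A red or blue component $H$ is partially invariant if $\gamma H=H$ for some $\gamma\in\mathcal{C}_n\setminus\{1\}$. A NAC-colouring $\delta$ of a $\mathcal{C}_n$-symmetric graph $G$ is $\mathcal{C}_n$-symmetric if $\delta(\gamma e)=\delta(e)$ for all $e\in E(G)$, $\gamma\in\mathcal{C}_n$, and no two distinct partially invariant red components are connected by an edge of $G$, and no two distinct partially invariant blue components are connected by an edge of $G$. *)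

(* Defs.v *)
From mathcomp Require Import all_boot all_order all_fingroup all_algebra.
From mathcomp Require Import all_classical all_reals all_analysis.

Set Implicit Arguments.
Unset Strict Implicit.
Unset Printing Implicit Defensive.

Import Order.TTheory GRing.Theory Num.Theory.
Import numFieldNormedType.Exports.

Local Open Scope ring_scope.

(* A graph is given by a finite vertex type [V] and an adjacency relation
   [e : rel V]; simplicity is [simple_graph e], and the edge joining [u] and
   [v] is the set [[set u; v]]. *)

Section Graph.
Variables (V : finType) (e : rel V).

Definition simple_graph : Prop := symmetric e /\ irreflexive e.

(* The empty graph satisfies this condition, but it carries no injective
   action of a nontrivial group. *)
Definition connected_graph : Prop := forall u v : V, connect e u v.

Definition graph_aut : {set {perm V}} :=
  [set s : {perm V} | [forall u, forall v, e (s u) (s v) == e u v]]%SET.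

End Graph.

Section CyclicAction.
(* For [1 < n], ['Z_n] is the cyclic group of order [n]. Its group law is
   written multiplicatively in [group_scope]; the generator omega is [Zp1] and
   the element omega^k, with [k < n], is the residue [k]. *)
Variables (V : finType) (e : rel V) (n : nat).
Variable theta : {morphism [set: 'Z_n]%SET >-> {perm V}}.

Definition acts_on_graph : Prop :=
  ('injm theta)%g /\ forall g : 'Z_n, theta g \in graph_aut e.

Definition invariant_vertex (v : V) : Prop :=
  forall g : 'Z_n, theta g v = v.

Definition partially_invariant_vertex (v : V) : Prop :=
  exists g : 'Z_n, g <> 1%g /\ theta g v = v.

Definition symmetric_graph : Prop :=
  [/\ acts_on_graph,
      forall v, partially_invariant_vertex v -> invariant_vertex v
    & forall u v, invariant_vertex u -> invariant_vertex v -> ~~ e u v].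

End CyclicAction.

Section Colouring.
Variables (V : finType) (e : rel V).

Definition red : bool := true.
Definition blue : bool := false.

(* The values of a colouring on sets that are not edges are irrelevant. *)
Variable delta : {set V} -> bool.

Definition cycle_colours (c : seq V) : seq bool :=
  [seq delta [set x; next c x]%SET | x <- c].

Definition NAC_colouring : Prop :=
  (forall col : bool, exists u v, e u v /\ delta [set u; v]%SET = col) /\
  (forall c : seq V, ucycle e c -> (3 <= size c)%N ->
     [\/ all (pred1 red) (cycle_colours c),
         all (pred1 blue) (cycle_colours c)
       | (2 <= count_mem red (cycle_colours c))%N /\
         (2 <= count_mem blue (cycle_colours c))%N]).

Definition mono_adj (col : bool) : rel V :=
  [rel u v | e u v && (delta [set u; v]%SET == col)].

(* A monochromatic component is identified with its vertex set. As a subgraph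
   it has all the [col]-coloured edges between these vertices, so for a
   colouring preserved by the action, invariance of the subgraph is invariance
   of its vertex set. *)
Definition mono_components (col : bool) : {set {set V}} :=
  [set [set v | connect (mono_adj col) u v] | u : V]%SET.

Variables (n : nat) (theta : {morphism [set: 'Z_n]%SET >-> {perm V}}).

Definition partially_invariant_component (H : {set V}) : Prop :=
  exists g : 'Z_n, g <> 1%g /\ (theta g @: H)%SET = H.

Definition symmetric_NAC_colouring : Prop :=
  [/\ NAC_colouring,
      forall (g : 'Z_n) u v, e u v ->
        delta [set theta g u; theta g v]%SET = delta [set u; v]%SET
    & forall (col : bool) (H1 H2 : {set V}),
        H1 \in mono_components col -> H2 \in mono_components col ->
        partially_invariant_component H1 ->
        partially_invariant_component H2 ->
        H1 <> H2 ->
        forall u v, u \in H1 -> v \in H2 -> ~~ e u v].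

End Colouring.

Section Framework.
Variables (R : realType) (V : finType) (e : rel V).

(* The library norm on matrices is the maximum norm. *)
Definition euclidean_norm (x : 'cV[R]_2) : R :=
  Num.sqrt (\sum_(i < 2) x i 0 ^+ 2).

Definition placement (p : V -> 'cV[R]_2) : Prop :=
  forall u v, e u v -> p u <> p v.

Definition equivalent_frameworks (p q : V -> 'cV[R]_2) : Prop :=
  forall u v, e u v ->
    euclidean_norm (p u - p v) = euclidean_norm (q u - q v).

Definition congruent (p q : V -> 'cV[R]_2) : Prop :=
  forall u v, euclidean_norm (p u - p v) = euclidean_norm (q u - q v).

(* Placements carry the topology of (R^2)^V, i.e. the product topology. Only
   the values of [P] on [0, 1] matter. *)
Definition flex (p : V -> 'cV[R]_2) (P : R -> V -> 'cV[R]_2) : Prop :=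
  [/\ {within `[0, 1], continuous (P : R -> {ptws V -> 'cV[R]_2})}%classic,
      P 0 = p
    & forall t : R, 0 <= t <= 1 ->
        placement (P t) /\ equivalent_frameworks (P t) p].

Definition trivial_flex (p : V -> 'cV[R]_2) (P : R -> V -> 'cV[R]_2) : Prop :=
  forall t : R, 0 <= t <= 1 -> congruent (P t) p.

Definition rotation_mx (a : R) : 'M[R]_2 :=
  \matrix_(i < 2, j < 2)
    if i == j then cos a else if i == 0 then - sin a else sin a.

Variables (n : nat) (theta : {morphism [set: 'Z_n]%SET >-> {perm V}}).

Definition tau (g : 'Z_n) : 'M[R]_2 :=
  rotation_mx (2 * (g : nat)%:R * pi / n%:R).

Definition symmetric_placement (p : V -> 'cV[R]_2) : Prop :=
  forall (g : 'Z_n) v, p (theta g v) = tau g *m p v.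

Definition symmetric_flexible (p : V -> 'cV[R]_2) : Prop :=
  exists P : R -> V -> 'cV[R]_2,
    [/\ flex p P,
        ~ trivial_flex p P
      & forall t : R, 0 <= t <= 1 -> symmetric_placement (P t)].

End Framework.

(* Main.v *)
Require Import Defs.
From mathcomp Require Import all_boot all_order all_fingroup all_algebra.
From mathcomp Require Import closed_field complex ring lra.
From mathcomp Require Import all_classical all_reals all_analysis.

(** A colouring gives a flex: identify the plane with the complex numbers and
    move the vertex [v] along [a (R v) + exp (i t) * a (B v)], where [R v] and
    [B v] are its red and blue components. The two endpoints of a red edge
    share the first summand, so their difference only rotates, and those of a
    blue edge share the second, so their difference is constant. The placement
    is symmetric as soon as [a] commutes with the action of the cyclic group
    ([equivariant_separating_map]); such an [a] must vanish on partially
    invariant components but can be injective elsewhere, which is why a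
    symmetric colouring keeps partially invariant components of the same colour
    apart. The flex is not trivial because some vertex lies both on a red and
    on a blue edge ([bicoloured_vertex]).

    A flex gives a colouring: regard [z = x + i y] and [w = x - i y] as
    independent complex unknowns. The squared length of an edge factors as
    [(z_u - z_v) * (w_u - w_v)], and the symmetry becomes multiplication of
    [z] by a root of unity and of [w] by its inverse. A non-trivial flex makes
    the quantity [(z_u - z_v) * (w_u - w_v)] take infinitely many values, for
    some pair of vertices [u], [v], over the solutions of this system. The set
    of these values is definable over an algebraically closed field, hence
    finite or cofinite by quantifier elimination, hence unbounded
    ([complex_configuration_unbounded]). The graph being connected, a solution
    for which this value is huge has edges [uv] whose [`|z_u - z_v|] are of very
    different sizes, and since there are few edges the sizes leave a large gap
    somewhere ([exists_gap]). Colour an edge red when it is below the gap and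
    blue when it is above, that is, when [`|w_u - w_v|] is small. Sums of a few
    small quantities remain small, so a path of one colour cannot join the ends
    of an edge of the other colour, which is the condition on cycles. A vertex
    in a partially invariant red component is joined by a red path to one of
    its images, so [(1 - zeta) * z_u] is small for a root of unity
    [zeta != 1], and therefore [z_u] itself is small; two such vertices cannot
    be joined by a blue edge. The same holds for blue with [w] in place of
    [z]. A single configuration with a large enough gap thus does the work of a
    valuation on the function field of the configuration space. *)

Set Implicit Arguments.
Unset Strict Implicit.
Unset Printing Implicit Defensive.

Import Order.TTheory GRing.Theory Num.Theory.
Import numFieldNormedType.Exports.

Local Open Scope ring_scope.

(** * Definable sets in algebraically closed fields *)

Lemma rterm_poly (F : fieldType) (t : GRing.term F) :
  GRing.rterm t -> exists p : {poly F}, forall x, GRing.eval [:: x] t = p.[x].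
Proof.
elim: t => [i|a|k|s IHs t IHt|s IHs|s IHs k|s IHs t IHt|s IHs|s IHs k] //=.
- move=> _; case: i => [|i]; first by exists 'X => x; rewrite hornerX.
  by exists 0 => x; rewrite horner0; case: i.
- by move=> _; exists a%:P => x; rewrite hornerC.
- by move=> _; exists k%:R => x; rewrite -polyC_natr hornerC.
- case/andP=> /IHs[p Ep] /IHt[q Eq]; exists (p + q) => x.
  by rewrite Ep Eq hornerD.
- by case/IHs=> p Ep; exists (- p) => x; rewrite Ep hornerN.
- by case/IHs=> p Ep; exists (p *+ k) => x; rewrite Ep hornerMn.
- case/andP=> /IHs[p Ep] /IHt[q Eq]; exists (p * q) => x.
  by rewrite Ep Eq hornerM.
- by case/IHs=> p Ep; exists (p ^+ k) => x; rewrite Ep horner_exp.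
Qed.

(** Algebraically closed fields are strongly minimal: after quantifier
    elimination, a formula in one variable is a boolean combination of
    polynomial equations, each of which is trivial or has finitely many
    solutions. *)
Lemma definable_finite_or_cofinite (F : closedFieldType) (f : GRing.formula F) :
  exists (s : seq F) (b : bool),
    forall x, x \notin s -> (GRing.holds [:: x] f <-> b).
Proof.
pose QE := ClosedFieldQE.holds_ex_elim (@GRing.solve_monicpoly F).
pose g := GRing.to_rform f.
have rg : GRing.rformula g := GRing.to_rform_rformula f.
pose h := GRing.quantifier_elim (@ClosedFieldQE.ex_elim F) g.
have hP x : reflect (GRing.holds [:: x] f) (GRing.qf_eval [:: x] h).
  pose wf := @ClosedFieldQE.wf_ex_elim F.
  apply: (iffP (GRing.quantifier_elim_rformP wf QE _ rg)).
    by move/GRing.to_rformP.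
  by move=> ?; apply/GRing.to_rformP.
have /andP[] : GRing.qf_form h && GRing.rformula h.
  exact: (GRing.quantifier_elim_wf (@ClosedFieldQE.wf_ex_elim F)).
suff aux k : GRing.qf_form k -> GRing.rformula k ->
    exists (s : seq F) (b : bool),
      forall x, x \notin s -> GRing.qf_eval [:: x] k = b.
  move=> qh rh; have [s [b sb]] := aux h qh rh; exists s, b => x /sb <-.
  by split => [/hP|/hP].
elim: k => [b|t1 t2|t|k1 IH1 k2 IH2|k1 IH1 k2 IH2|k1 IH1 k2 IH2|k1 IH1|i k1 _
  |i k1 _] //=.
- by move=> _ _; exists [::], b.
- move=> _ /andP[/rterm_poly[p Ep] /rterm_poly[q Eq]].
  case: (eqVneq p q) Ep Eq => [->|pq] Ep Eq.
    by exists [::], true => x _; rewrite Ep Eq eqxx.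
  have [s Es] := closed_field_poly_normal (p - q).
  exists s, false => x xs; rewrite Ep Eq -subr_eq0 -hornerN -hornerD Es hornerZ.
  rewrite mulf_eq0 lead_coef_eq0 subr_eq0 (negPf pq) /=.
  by apply: contraNF xs => /eqP x0; rewrite -root_prod_XsubC; apply/eqP.
- move=> /andP[q1 q2] /andP[r1 r2].
  have [s1 [b1 e1]] := IH1 q1 r1; have [s2 [b2 e2]] := IH2 q2 r2.
  exists (s1 ++ s2), (b1 && b2) => x.
  by rewrite mem_cat negb_or => /andP[/e1-> /e2->].
- move=> /andP[q1 q2] /andP[r1 r2].
  have [s1 [b1 e1]] := IH1 q1 r1; have [s2 [b2 e2]] := IH2 q2 r2.
  exists (s1 ++ s2), (b1 || b2) => x.
  by rewrite mem_cat negb_or => /andP[/e1-> /e2->].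
- move=> /andP[q1 q2] /andP[r1 r2].
  have [s1 [b1 e1]] := IH1 q1 r1; have [s2 [b2 e2]] := IH2 q2 r2.
  exists (s1 ++ s2), (b1 ==> b2) => x.
  by rewrite mem_cat negb_or => /andP[/e1-> /e2->].
- move=> q1 r1; have [s1 [b1 e1]] := IH1 q1 r1.
  by exists s1, (~~ b1) => x /e1->.
Qed.

Lemma definable_infinite_unbounded (F : numClosedFieldType)
    (f : GRing.formula F) :
  (forall s : seq F, exists2 x, x \notin s & GRing.holds [:: x] f) ->
  forall K : F, 0 <= K -> exists2 x, K <= `|x| & GRing.holds [:: x] f.
Proof.
move=> inf K K0; have [s [b sb]] := definable_finite_or_cofinite f.
have bT : b by have [x xs /(sb x xs)] := inf s.
(* [size s + 1] distinct large numbers, one of which avoids [s] *)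
pose r := [seq K + i%:R | i <- iota 0 (size s).+1].
have ur : uniq r.
  rewrite map_inj_uniq ?iota_uniq // => i j /addrI /eqP.
  by rewrite eqr_nat => /eqP.
have [x xr xs] : exists2 x, x \in r & x \notin s.
  apply/hasP; rewrite has_predC; apply/negP => /allP rs.
  by have := uniq_leq_size ur rs; rewrite size_map size_iota ltnn.
exists x; last exact/(sb x xs).
by case/mapP: xr => i _ ->; rewrite ger0_norm ?addr_ge0 // lerDl.
Qed.

(** A formula in [N + 1] variables defines, by projection to the variable of
    index 0, a set to which the previous lemma applies; an environment beyond
    its length is read as 0, whence the bound on its size. *)
Lemma definable_first_coord_unbounded (F : numClosedFieldType)
    (f : GRing.formula F) (N : nat) :
  (forall s : seq F, exists env : seq F,
     [/\ (size env <= N.+1)%N, GRing.holds env f & env`_0 \notin s]) ->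
  forall K : F, 0 <= K ->
  exists env : seq F, GRing.holds env f /\ K <= `|env`_0|.
Proof.
move=> inf K K0; pose g := foldr GRing.Exists f (iota 1 N).
have [s|x Kx /GRing.foldExistsP[env envE fenv]] :=
    definable_infinite_unbounded (f := g) _ K0.
  have [env [sz fenv env0]] := inf s; exists env`_0 => //.
  apply/GRing.foldExistsP; exists env => // i.
  rewrite inE /= mem_iota; case: i => [|i] //=; rewrite add1n -leqNgt => Ni.
  by rewrite !nth_default // (leq_trans sz).
by exists env; rewrite -(envE 0) // inE /= mem_iota.
Qed.

Definition forallF (F : fieldType) (J : finType) (f : J -> GRing.formula F) :=
  foldr (fun j => GRing.And (f j)) (GRing.Bool true) (enum J).

Lemma holds_forallF (F : fieldType) (J : finType) (f : J -> GRing.formula F)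
    env :
  GRing.holds env (forallF f) <-> forall j, GRing.holds env (f j).
Proof.
rewrite /forallF; split=> [H j|H].
  have: j \in enum J by rewrite mem_enum.
  elim: (enum J) H => //= i s IH [fi /IH{}IH].
  by rewrite inE => /predU1P[->|/IH].
by elim: (enum J) => //= i s IH.
Qed.

(** The equations of a symmetric framework in the coordinates [z = x + i y] and
    [w = x - i y], where [z] and [w] need no longer be conjugate. *)
Definition complex_configuration (C : fieldType) (V : finType) (e : rel V)
    (I : finType) (sigma : I -> V -> V) (chi : I -> C) (len2 : V -> V -> C)
    (z w : V -> C) : Prop :=
  (forall u v, e u v -> (z u - z v) * (w u - w v) = len2 u v) /\
  (forall i v,
     z (sigma i v) = chi i * z v /\ w (sigma i v) = (chi i)^-1 * w v).

(** The system is a formula whose variable of index 0 is the value of interest;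
    [z] and [w] occupy the next [2 * #|V|] variables. *)
Lemma complex_configuration_unbounded (C : numClosedFieldType) (V : finType)
    (e : rel V) (I : finType) (sigma : I -> V -> V) (chi : I -> C)
    (len2 : V -> V -> C) (a b : V) :
  (forall s : seq C, exists z w, complex_configuration e sigma chi len2 z w /\
     (z a - z b) * (w a - w b) \notin s) ->
  forall K : C, 0 <= K ->
  exists z w, complex_configuration e sigma chi len2 z w /\
    K <= `|(z a - z b) * (w a - w b)|.
Proof.
move=> inf K K0.
pose zX (v : V) := GRing.Var C (enum_rank v).+1.
pose wX (v : V) := GRing.Var C (#|V| + enum_rank v).+1.
pose sub s t : GRing.term C := GRing.Add s (GRing.Opp t).
pose d u v := GRing.Mul (sub (zX u) (zX v)) (sub (wX u) (wX v)).
pose edges := forallF (fun uv : V * V => if e uv.1 uv.2 then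
  GRing.Equal (d uv.1 uv.2) (GRing.Const (len2 uv.1 uv.2))
  else GRing.Bool true).
pose sym := forallF (fun iv : I * V => GRing.And
  (GRing.Equal (zX (sigma iv.1 iv.2))
     (GRing.Mul (GRing.Const (chi iv.1)) (zX iv.2)))
  (GRing.Equal (wX (sigma iv.1 iv.2))
     (GRing.Mul (GRing.Const (chi iv.1)^-1) (wX iv.2)))).
pose f := GRing.And (GRing.Equal (GRing.Var C 0) (d a b)) (GRing.And edges sym).
pose zof (env : seq C) (v : V) := env`_(enum_rank v).+1.
pose wof (env : seq C) (v : V) := env`_(#|V| + enum_rank v).+1.
have fP env : GRing.holds env f <->
    complex_configuration e sigma chi len2 (zof env) (wof env) /\
    env`_0 = (zof env a - zof env b) * (wof env a - wof env b).
  split=> [[E0 [/holds_forallF Ee /holds_forallF Es]]|[[Ee Es] E0]].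
    split; last exact: E0.
    split=> [u v euv|i v]; last exact: (Es (i, v)).
    by have := Ee (u, v); rewrite /= euv.
  split=> //; split; apply/holds_forallF => -[u v] /=; last exact: Es.
  by case: ifP => // /Ee.
have [s|env [/fP[cfg ->] Kenv]] :=
    definable_first_coord_unbounded (f := f) (N := #|V| + #|V|) _ K0;
  last first.
  by exists (zof env), (wof env).
have [z [w [cfg zw]]] := inf s.
pose env :=
  ((z a - z b) * (w a - w b)) :: map z (enum V) ++ map w (enum V).
have zE : zof env = z.
  apply/funext => v; rewrite /zof /= nth_cat size_map -cardE ltn_ord.
  by rewrite (nth_map v) -?cardE ?ltn_ord // nth_enum_rank.
have wE : wof env = w.
  apply/funext => v; rewrite /wof /= nth_cat size_map -cardE ltnNge leq_addr /=.
  by rewrite addKn (nth_map v) -?cardE ?ltn_ord // nth_enum_rank.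
exists env; split => //; last by apply/fP; rewrite zE wE.
by rewrite -[size env]/(size (_ ++ _)).+1 size_cat !size_map -!enumT -!cardT.
Qed.

(** * Gaps and sums of small quantities *)

Lemma connect_norm_bound (C : numDomainType) (V : finType) (r : rel V)
    (h : V -> C) (beta : C) (u v : V) :
  0 <= beta -> (forall x y, r x y -> `|h x - h y| <= beta) ->
  connect r u v -> `|h u - h v| <= beta *+ #|V|.
Proof.
move=> beta0 hr /connectP[p0 /shortenP[p pr up _] ->] {p0}.
suff le_size : `|h u - h (last u p)| <= beta *+ size p.
  apply: le_trans le_size _; rewrite ler_wpMn2l //.
  have /andP[_ /card_uniqP <-] := up; exact: max_card.
elim: p u pr {up} => [|x p IH] u /=; first by rewrite subrr normr0.
case/andP=> /hr ux /IH{}IH; rewrite mulrS -(subrKA (h x)).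
by rewrite (le_trans (ler_normD _ _)) // lerD.
Qed.

(** Pigeonhole: the scale from [f i0] to [f j0] has room for [#|I| + 1]
    successive ranges of ratio [G], and each of the [#|I|] indices spoils at
    most one of them. *)
Lemma exists_gap (C : numDomainType) (I : finType) (A : {pred I}) (f : I -> C)
    (G : C) (i0 j0 : I) :
  (forall i, i \in A -> 0 < f i) -> 1 <= G -> i0 \in A -> j0 \in A ->
  G ^+ #|I|.+1 * f i0 < f j0 ->
  exists alpha : C,
    [/\ 0 < alpha, forall i, i \in A -> f i <= alpha \/ G * alpha < f i,
        exists2 i, i \in A & f i <= alpha
      & exists2 j, j \in A & G * alpha < f j].
Proof.
move=> f0 G1 Ai0 Aj0 big; have G0 : 0 < G by rewrite (lt_le_trans ltr01).
pose al k := G ^+ k * f i0.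
have al0 k : 0 < al k by rewrite mulr_gt0 ?exprn_gt0 ?f0.
have alS k : G * al k = al k.+1 by rewrite /al exprS mulrA.
have al_mono k l : (k <= l)%N -> al k <= al l.
  by move=> kl; rewrite ler_wpM2r ?(ltW (f0 _ _)) ?ler_weXn2l.
have [/existsP[k /forall_inP gap]|] := boolP [exists k : 'I_#|I|.+1,
    [forall i in A, (f i <= al k) || (G * al k < f i)]].
  exists (al k); split => //.
  - by move=> i /gap/orP.
  - by exists i0 => //; rewrite (le_trans _ (al_mono 0%N k _)) // /al mul1r.
  - by exists j0 => //; rewrite alS (le_lt_trans (al_mono _ _ (ltn_ord k))).
rewrite negb_exists => /forallP nogap; exfalso.
have /fin_all_exists[F FP] (k : 'I_#|I|.+1) : exists i, al k < f i <= al k.+1.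
  have := nogap k; rewrite negb_forall => /existsP[j].
  rewrite negb_imply negb_or alS => /andP[Aj].
  have fR : f j \is Num.real by rewrite ger0_real ?ltW ?f0.
  have aR k' : al k' \is Num.real by rewrite ger0_real ?ltW.
  by rewrite -real_ltNge // -real_leNgt //; exists j.
suff /leq_card : injective F by rewrite card_ord ltnn.
have lt_neq (k l : 'I_#|I|.+1) : (k < l)%N -> F k = F l -> False.
  move=> /al_mono kl E; have /andP[_ ub] := FP k; have /andP[lb _] := FP l.
  have := lt_le_trans lb; rewrite -E => /(_ _ (le_trans ub kl)).
  by rewrite ltxx.
move=> k l E; apply: val_inj; case: (ltngtP k l) => // kl.
  by case: (lt_neq _ _ kl E).
by case: (lt_neq _ _ kl (esym E)).
Qed.

(** * The condition on cycles, in terms of monochromatic paths *)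

Section MonochromaticPaths.
Variables (V : finType) (e : rel V) (delta : {set V} -> bool).

Let edge_colour (x y : V) := delta [set x; y]%SET.

Lemma cycle_colours_cons x p : uniq (x :: p) ->
  cycle_colours delta (x :: p) = pairmap edge_colour x (rcons p x).
Proof.
move=> up; apply: (@eq_from_nth _ true); rewrite /cycle_colours size_map.
  by rewrite size_pairmap size_rcons.
move=> i ip; rewrite (nth_map x) // (nth_pairmap x) ?size_rcons //.
rewrite next_nth mem_nth // index_uniq // /edge_colour.
have -> : nth x (x :: rcons p x) i = nth x (x :: p) i.
  by rewrite -rcons_cons nth_rcons ip.
rewrite nth_rcons; move: ip; rewrite /= ltnS.
by case: ltngtP => // -> _; rewrite [nth x p _]nth_default.
Qed.

Lemma mono_path col x p :
  path e x p -> all (pred1 col) (pairmap edge_colour x p) ->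
  path (mono_adj e delta col) x p.
Proof.
elim: p x => //= y p IH x /andP[exy /IH{}IH] /andP[cxy /IH->].
by rewrite andbT /mono_adj /= exy.
Qed.

Lemma mono_path_colours col x p : path (mono_adj e delta col) x p ->
  pairmap edge_colour x p = nseq (size p) col.
Proof.
by elim: p x => //= y p IH x /andP[/andP[_ /eqP cxy] /IH->]; rewrite -cxy.
Qed.

Lemma mono_adj_sym col : symmetric e -> symmetric (mono_adj e delta col).
Proof. by move=> sym x y; rewrite /mono_adj /= sym finset.setUC. Qed.

Hypotheses (e_sym : symmetric e) (e_irr : irreflexive e).

Definition NAC_cycles := forall c : seq V, ucycle e c -> (3 <= size c)%N ->
  [\/ all (pred1 red) (cycle_colours delta c),
      all (pred1 blue) (cycle_colours delta c)
    | (2 <= count_mem red (cycle_colours delta c))%N /\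
      (2 <= count_mem blue (cycle_colours delta c))%N].

(** Otherwise the edge and a shortest monochromatic path between its ends would
    form a cycle with exactly one edge of the other colour. *)
Lemma NAC_cycles_mono_connect col u v : NAC_cycles ->
  e u v -> connect (mono_adj e delta col) u v -> delta [set u; v]%SET = col.
Proof.
move=> nac euv /connectP[p0 /shortenP[p pp up _] vE] {p0}.
apply/eqP/negPn/negP => ncol.
have size_p : (2 <= size p)%N.
  case: p pp vE {up} => [|x [|y p]] //=.
    by move=> _ vu; rewrite vu e_irr in euv.
  by move=> /andP[/andP[_ cux] _] vx; rewrite vx cux in ncol.
have cyc : ucycle e (u :: p).
  rewrite /ucycle up andbT /= rcons_path -vE e_sym euv andbT.
  by apply: sub_path pp => x y /andP[].
have := nac _ cyc size_p; rewrite cycle_colours_cons //.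
rewrite -cats1 pairmap_cat (mono_path_colours pp) /= -vE /edge_colour.
rewrite finset.setUC.
rewrite !all_cat !count_cat !all_nseq !count_nseq /= !andbT !addn0.
case: p size_p {pp up vE cyc} => // x p _.
by case: col ncol; case: (delta _) => //= _; rewrite mul0n => -[||[]].
Qed.

(** Conversely, removing from a cycle its only edge of some colour leaves a
    path of the other colour between the ends of that edge. *)
Lemma mono_connect_NAC_cycles :
  (forall col u v, e u v -> connect (mono_adj e delta col) u v ->
     delta [set u; v]%SET = col) -> NAC_cycles.
Proof.
move=> mono c /andP[cyc uc] size_c; set cs := cycle_colours delta c.
have not1 col : count_mem (~~ col) cs != 1%N.
  apply/eqP => cnt; have /mapP[x xc xE] : ~~ col \in cs.
    by rewrite -has_pred1 has_count cnt.
  have [i s cE] := rot_to xc.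
  have us : uniq (x :: s) by rewrite -cE rot_uniq.
  have := cyc; rewrite -(rot_cycle i) cE.
  have cntr : count_mem (~~ col) (cycle_colours delta (x :: s)) = 1%N.
    have -> : cycle_colours delta (x :: s) = rot i cs.
      rewrite -cE /cs /cycle_colours -map_rot.
      by apply: eq_map => y; rewrite next_rot.
    by rewrite -cnt; apply/seq.permP; rewrite perm_rot.
  have xE' : ~~ col = edge_colour x (next (x :: s) x).
    by rewrite -cE next_rot.
  move: cntr; rewrite cycle_colours_cons //.
  have: (2 <= size s)%N by have := size_c; rewrite -(size_rot i) cE.
  case: s us cE xE' => // y s us cE; rewrite /= eqxx => xE' _.
  rewrite -xE' eqxx add1n => -[/eqP cnt0] /andP[exy ps].
  suff cyx : connect (mono_adj e delta col) y x.
    have := mono _ _ _ _ cyx; rewrite e_sym exy finset.setUC => /(_ isT) xyE.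
    by move: xE'; rewrite /edge_colour xyE; case: col {cnt cnt0 xE cyx xyE}.
  apply/connectP; exists (rcons s x); last by rewrite last_rcons.
  apply: mono_path ps _; apply: contraTT cnt0 => /allPn[b bs bcol].
  rewrite -lt0n -has_count; apply/hasP; exists b => //=.
  by case: b col bcol {cnt xE xE' bs} => [] [].
have [r1 b1] : count_mem red cs != 1%N /\ count_mem blue cs != 1%N.
  by split; [exact: (not1 blue) | exact: (not1 red)].
have all_col col : (count_mem (~~ col) cs == 0)%N = all (pred1 col) cs.
  rewrite eqn0Ngt -has_count -all_predC; apply: eq_all => b /=.
  by case: b col => [] [].
have [/eqP|r0] := eqVneq (count_mem red cs) 0%N.
  by rewrite (all_col blue); constructor 2.
have [/eqP|b0] := eqVneq (count_mem blue cs) 0%N.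
  by rewrite (all_col red); constructor 1.
by constructor 3; split; rewrite ltn_neqAle eq_sym lt0n; apply/andP.
Qed.
End MonochromaticPaths.

(** * From a configuration with a gap to a colouring *)

Section OneColour.
Variables (C : numDomainType) (V : finType) (e : rel V).
Variable delta : {set V} -> bool.
Variables (n : nat) (theta : {morphism [set: 'Z_n]%SET >-> {perm V}}).
(** One colour at a time: [h] varies little along the edges of colour [col] and
    much along the others. This is used with [h = z] for red and with [h = w]
    for blue. *)
Variables (col : bool) (h : V -> C) (chi : 'Z_n -> C) (beta B : C).
Hypothesis e_sym : symmetric e.
Hypotheses (beta0 : 0 <= beta) (B1 : 1 <= B).
Hypothesis h_theta : forall g v, h (theta g v) = chi g * h v.
Hypothesis chi_far : forall g : 'Z_n, g <> 1%g -> 1 <= B * `|1 - chi g|.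
Hypothesis small : forall u v, e u v -> delta [set u; v]%SET = col ->
  `|h u - h v| <= beta.
(* [B * (beta *+ #|V|)] bounds [h] on partially invariant components, so its
   double bounds the difference of [h] between two of them. *)
Hypothesis large : forall u v, e u v -> delta [set u; v]%SET <> col ->
  (B * (beta *+ #|V|)) *+ 2 < `|h u - h v|.

Lemma mono_connect_small u v :
  connect (mono_adj e delta col) u v -> `|h u - h v| <= beta *+ #|V|.
Proof.
by apply: connect_norm_bound => // x y /andP[exy /eqP]; exact: small.
Qed.

Lemma small_same_colour u v : e u v ->
  `|h u - h v| <= (B * (beta *+ #|V|)) *+ 2 -> delta [set u; v]%SET = col.
Proof.
move=> euv le; apply/eqP/negPn/negP => /eqP /(large euv) lt.
by have := lt_le_trans lt le; rewrite ltxx.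
Qed.

Lemma mono_connect_colour u v : e u v ->
  connect (mono_adj e delta col) u v -> delta [set u; v]%SET = col.
Proof.
move=> euv /mono_connect_small le; apply: small_same_colour => //.
have b0 : 0 <= beta *+ #|V| by rewrite mulrn_wge0.
have B0 : 0 <= B := le_trans ler01 B1.
apply: le_trans le _; apply: (@le_trans _ _ (B * (beta *+ #|V|))).
  by rewrite ler_peMl.
by rewrite mulr2n lerDl mulr_ge0.
Qed.

Lemma in_mono_component H u v : H \in mono_components e delta col ->
  u \in H -> v \in H -> connect (mono_adj e delta col) u v.
Proof.
case/imsetP=> r _ ->; rewrite !inE => ru rv.
rewrite (connect_trans _ rv) //.
by rewrite (sym_connect_sym (mono_adj_sym delta col e_sym)).
Qed.

(** If [theta g] preserves the component of [u], then [h u] and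
    [h (theta g u) = chi g * h u] are close, and [chi g] is far from 1. *)
Lemma partially_invariant_small H u : H \in mono_components e delta col ->
  partially_invariant_component theta H -> u \in H ->
  `|h u| <= B * (beta *+ #|V|).
Proof.
move=> Hc [g [g1 gH]] uH.
have guH : theta g u \in H by rewrite -gH imset_f.
have := mono_connect_small (in_mono_component Hc uH guH).
rewrite h_theta -[X in X - _]mul1r -mulrBl normrM => le.
have B0 : 0 <= B := le_trans ler01 B1.
apply: le_trans (ler_wpM2l B0 le); rewrite mulrA.
by rewrite ler_peMl // chi_far.
Qed.

Lemma partially_invariant_components_apart (H1 H2 : {set V}) :
  H1 \in mono_components e delta col -> H2 \in mono_components e delta col ->
  partially_invariant_component theta H1 ->
  partially_invariant_component theta H2 -> H1 <> H2 ->
  forall u v, u \in H1 -> v \in H2 -> ~~ e u v.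
Proof.
move=> c1 c2 p1 p2 neq u v u1 v2; apply/negP => euv; apply: neq.
have le1 := partially_invariant_small c1 p1 u1.
have le2 := partially_invariant_small c2 p2 v2.
have uv : delta [set u; v]%SET = col.
  apply: small_same_colour => //; rewrite mulr2n.
  by rewrite (le_trans (ler_normB _ _)) // lerD.
have auv : connect (mono_adj e delta col) u v.
  by apply: connect1; rewrite /mono_adj /= euv uv eqxx.
have csym := sym_connect_sym (mono_adj_sym delta col e_sym).
have [[r1 _ E1] [r2 _ E2]] := (imsetP c1, imsetP c2).
move: u1 v2; rewrite E1 E2 !inE => r1u r2v.
have r12 : connect (mono_adj e delta col) r1 r2.
  by rewrite (connect_trans r1u) // (connect_trans auv) // csym.
by apply/finset.setP => x; rewrite !inE (same_connect csym r12).
Qed.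
End OneColour.

Section FromConfiguration.
Variables (C : numClosedFieldType) (V : finType) (e : rel V).
Variables (n : nat) (theta : {morphism [set: 'Z_n]%SET >-> {perm V}}).
Variables (chi : 'Z_n -> C) (len2 : V -> V -> C).
Hypotheses (e_sym : symmetric e) (e_irr : irreflexive e).
Hypothesis theta_aut : forall g u v, e (theta g u) (theta g v) = e u v.
Hypothesis chi_norm : forall g, `|chi g| = 1.
Variables (B L : C).
Hypotheses (B1 : 1 <= B) (L1 : 1 <= L).
Hypothesis chi_far : forall g : 'Z_n, g <> 1%g -> 1 <= B * `|1 - chi g|.
Hypothesis len_le : forall u v, e u v -> `|len2 u v| <= L.
Hypothesis len_ge : forall u v, e u v -> 1 <= L * `|len2 u v|.

(** With this ratio, [small] and [large] above hold for [z] and red, and also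
    for [w] and blue: as [`|z u - z v| * `|w u - w v|] is between [1 / L] and
    [L], the gap for [w] is smaller than the one for [z] by a factor of at most
    [L ^+ 2]. *)
Definition gap_ratio := (B * L ^+ 2) *+ #|V| *+ 2 + 1.

Lemma gap_ratio_ge1 : 1 <= gap_ratio.
Proof.
have L0 : 0 <= L := le_trans ler01 L1.
have B0 : 0 <= B := le_trans ler01 B1.
by rewrite lerDr !mulrn_wge0 // mulr_ge0 // exprn_ge0.
Qed.

Lemma gap_NAC_colouring (z w : V -> C) (alpha : C) :
  complex_configuration e (fun g => theta g) chi len2 z w -> 0 < alpha ->
  (forall u v, e u v ->
     `|z u - z v| <= alpha \/ gap_ratio * alpha < `|z u - z v|) ->
  (exists u v, e u v /\ `|z u - z v| <= alpha) ->
  (exists u v, e u v /\ gap_ratio * alpha < `|z u - z v|) ->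
  exists delta : {set V} -> bool, symmetric_NAC_colouring e delta theta.
Proof.
move=> [edges sym] a0 gap [r1 [r2 [er rle]]] [b1 [b2 [eb ble]]].
pose delta (S : {set V}) := [exists u, exists v,
  [&& S == [set u; v]%SET, e u v & `|z u - z v| <= alpha]].
have deltaE u v : e u v -> delta [set u; v]%SET = (`|z u - z v| <= alpha).
  move=> euv; apply/idP/idP=> [|le]; last first.
    by apply/existsP; exists u; apply/existsP; exists v; rewrite eqxx euv.
  case/existsP=> x /existsP[y /and3P[/eqP uvE exy le]].
  have /set2P xE : x \in [set u; v]%SET by rewrite uvE set21.
  have /set2P yE : y \in [set u; v]%SET by rewrite uvE set22.
  case: xE yE exy le => -> [] -> //; rewrite ?e_irr //.
  by rewrite distrC.
have L0 : 0 < L := lt_le_trans ltr01 L1.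
have B0 : 0 < B := lt_le_trans ltr01 B1.
have G1 := gap_ratio_ge1.
have G0 : 0 < gap_ratio := lt_le_trans ltr01 G1.
have blueE u v : e u v -> delta [set u; v]%SET = blue ->
    gap_ratio * alpha < `|z u - z v|.
  by move=> euv; rewrite deltaE //; case: (gap u v euv) => [->|].
have lenE u v : e u v -> `|len2 u v| = `|z u - z v| * `|w u - w v|.
  by move=> euv; rewrite -edges // normrM.
have z_theta g v : z (theta g v) = chi g * z v by case: (sym g v).
have w_theta g v : w (theta g v) = (chi g)^-1 * w v by case: (sym g v).
have chiV_far (g : 'Z_n) : g <> 1%g -> 1 <= B * `|1 - (chi g)^-1|.
  move=> /chi_far; have c0 : chi g != 0 by rewrite -normr_eq0 chi_norm oner_eq0.
  rewrite -[X in _ -> _ <= _ * X]mulr1.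
  rewrite -[X in _ -> _ <= _ * (_ * X)](chi_norm g).
  by rewrite -normrM mulrBl mul1r mulVf // distrC.
have red_small u v : e u v -> delta [set u; v]%SET = red ->
    `|z u - z v| <= alpha.
  by move=> euv; rewrite deltaE.
have red_large u v : e u v -> delta [set u; v]%SET <> red ->
    (B * (alpha *+ #|V|)) *+ 2 < `|z u - z v|.
  move=> euv /eqP; rewrite eqb_id => /negPf /(blueE _ _ euv).
  apply: le_lt_trans.
  rewrite mulrnAr -!mulrnAl (ler_wpM2r (ltW a0)) // /gap_ratio.
  apply: (@le_trans _ _ ((B * L ^+ 2) *+ #|V| *+ 2)); last by rewrite lerDl.
  by do 2 apply: ler_wMn2r; rewrite (ler_peMr (ltW B0)) ?exprn_ege1.
pose beta := L / (gap_ratio * alpha).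
have Ga0 : 0 < gap_ratio * alpha by rewrite mulr_gt0.
have beta0 : 0 <= beta by rewrite divr_ge0 ?ltW.
have blue_small u v : e u v -> delta [set u; v]%SET = blue ->
    `|w u - w v| <= beta.
  move=> euv /(blueE _ _ euv) lt; rewrite ler_pdivlMr //.
  apply: le_trans (len_le euv); rewrite lenE // mulrC.
  by rewrite ler_wpM2r // ltW.
have blue_large u v : e u v -> delta [set u; v]%SET <> blue ->
    (B * (beta *+ #|V|)) *+ 2 < `|w u - w v|.
  move=> euv /eqP; rewrite eqbF_neg negbK => /(red_small _ _ euv) le.
  have la : 1 <= L * alpha * `|w u - w v|.
    apply: le_trans (len_ge euv) _; rewrite lenE // -mulrA.
    by rewrite (ler_wpM2l (ltW L0)) ?ler_wpM2r.
  have La0 : 0 < L * alpha by rewrite mulr_gt0.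
  rewrite -(ltr_pM2l La0); apply: lt_le_trans la.
  rewrite /beta -mulr_natr -[_ *+ #|V|]mulr_natr.
  rewrite -(ltr_pM2r Ga0) mul1r.
  have -> : L * alpha * (B * (L / (gap_ratio * alpha) * #|V|%:R) * 2%:R) *
      (gap_ratio * alpha) = (B * L ^+ 2) *+ #|V| *+ 2 * alpha.
    rewrite -[B * L ^+ 2 *+ #|V|]mulr_natr -[X in _ = X * _]mulr_natr.
    have Gan0 := lt0r_neq0 Ga0.
    set G := gap_ratio * alpha in Gan0 *.
    have -> : L * alpha * (B * (L / G * #|V|%:R) * 2%:R) * G =
      L * alpha * B * L * #|V|%:R * 2%:R * (G^-1 * G) by rewrite !mulrA; ring.
    by rewrite mulVf // mulr1; ring.
  by rewrite ltr_pM2r // ltrDl.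
exists delta; split.
- split.
    case; [exists r1, r2 | exists b1, b2]; split=> //; rewrite deltaE //.
    apply/negbTE/negP => le.
    have aG : alpha <= gap_ratio * alpha by rewrite (ler_peMl (ltW a0)).
    by have := le_lt_trans (le_trans le aG) ble; rewrite ltxx.
  apply: (mono_connect_NAC_cycles e_sym) => -[] u v euv.
    exact: (mono_connect_colour (ltW a0) B1 red_small red_large).
  exact: (mono_connect_colour beta0 B1 blue_small blue_large).
- move=> g u v euv; rewrite !deltaE ?theta_aut //.
  by rewrite !z_theta -mulrBr normrM chi_norm mul1r.
- case.
    exact: (partially_invariant_components_apart e_sym (ltW a0) B1 z_theta
      chi_far red_small red_large).
  exact: (partially_invariant_components_apart e_sym beta0 B1 w_theta
    chiV_far blue_small blue_large).
Qed.

(** If the sizes of the edges in [z] were all within a factor [Q] of one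
    another, then summing along a path from [a] to [b] would bound both
    [z a - z b] and [w a - w b], and hence their product. *)
Lemma large_configuration_NAC_colouring (z w : V -> C) (a b : V) :
  connect e a b -> complex_configuration e (fun g => theta g) chi len2 z w ->
  (L * (gap_ratio ^+ #|{: V * V}|.+1) ^+ 2) *+ #|V| *+ #|V| <
    `|(z a - z b) * (w a - w b)| ->
  exists delta : {set V} -> bool, symmetric_NAC_colouring e delta theta.
Proof.
move=> ab cfg; have [edges _] := cfg; set Q := gap_ratio ^+ _ => big.
have L0 : 0 < L := lt_le_trans ltr01 L1.
have G1 := gap_ratio_ge1.
have Q0 : 0 < Q by rewrite exprn_gt0 // (lt_le_trans ltr01).
pose f (uv : V * V) := `|z uv.1 - z uv.2|.
pose A : {pred V * V} := [pred uv | e uv.1 uv.2].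
have lenE u v : e u v -> `|len2 u v| = `|z u - z v| * `|w u - w v|.
  by move=> euv; rewrite -edges // normrM.
have f0 uv : uv \in A -> 0 < f uv.
  move=> Auv; rewrite normr_gt0; apply/eqP => fz.
  have := len_ge Auv; rewrite lenE // fz normr0 mul0r mulr0.
  by rewrite ler10.
have fR uv : f uv \is Num.real by apply: normr_real.
have [|nobig] := boolP [exists i in A, exists j in A, Q * f i < f j].
  case/exists_inP=> i0 Ai0 /exists_inP[j0 Aj0 ij].
  have [al [al0 gap [[r1 r2] Ar rle] [[b1 b2] Ab blt]]] :=
    exists_gap f0 G1 Ai0 Aj0 ij.
  apply: (gap_NAC_colouring cfg al0); [|by exists r1, r2|by exists b1, b2].
  by move=> u v euv; apply: (gap (u, v)).
have fle i j : i \in A -> j \in A -> f j <= Q * f i.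
  move=> Ai Aj; rewrite real_leNgt ?realM ?(gtr0_real Q0) //.
  apply: contra nobig => lt; apply/exists_inP; exists i => //.
  by apply/exists_inP; exists j.
have [xy Axy] : exists xy, xy \in A.
  case/connectP: (ab) => [[|x p]] /= => [_ ba|/andP[ax _] _]; last first.
    by exists (a, x).
  move: big; rewrite ba subrr mul0r normr0 le_gtF //.
  do 2 apply: mulrn_wge0; apply: mulr_ge0 (ltW L0) _.
  exact: exprn_ge0 (ltW Q0).
have zle : `|z a - z b| <= (Q * f xy) *+ #|V|.
  apply: connect_norm_bound ab; first by rewrite ltW // mulr_gt0 ?f0.
  by move=> u v euv; apply: (fle xy (u, v)).
have wle : `|w a - w b| <= (L * Q / f xy) *+ #|V|.
  apply: connect_norm_bound ab; first by rewrite ltW // divr_gt0 ?f0 ?mulr_gt0.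
  move=> u v euv; rewrite ler_pdivlMr ?f0 //.
  have fuv : 0 < `|z u - z v| := f0 (u, v) euv.
  have le : `|w u - w v| * f xy <= `|w u - w v| * (Q * `|z u - z v|).
    by rewrite ler_wpM2l //; apply: (fle (u, v) xy).
  apply: le_trans le _; rewrite mulrCA [X in _ * X]mulrC -lenE // mulrC.
  by rewrite (ler_wpM2r (ltW Q0)) ?len_le.
have := lt_le_trans big
  (_ : _ <= (Q * f xy) *+ #|V| * ((L * Q / f xy) *+ #|V|)).
rewrite normrM ler_pM // => /(_ isT).
have fn0 := lt0r_neq0 (f0 _ Axy).
suff -> : Q * f xy *+ #|V| * (L * Q / f xy *+ #|V|) =
    L * Q ^+ 2 *+ #|V| *+ #|V|.
  by rewrite ltxx.
rewrite mulrnAl mulrnAr; congr (_ *+ _ *+ _).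
by field.
Qed.
End FromConfiguration.

(** * Complex coordinates in the plane *)

Definition expi (R : realType) (a : R) : R[i] := (cos a +i* sin a)%C.

Lemma expiD (R : realType) (a b : R) : expi (a + b) = expi a * expi b.
Proof. by rewrite /expi cosD sinD; simpc; congr (_ +i* _)%C; rewrite addrC. Qed.

Lemma norm_expi (R : realType) (a : R) : `|expi a| = 1.
Proof. by rewrite normc_def /= cos2Dsin2 sqrtr1. Qed.

Lemma expiMn (R : realType) (a : R) k : expi (a *+ k) = expi a ^+ k.
Proof.
elim: k => [|k IH]; last by rewrite mulrS expiD IH exprS.
by rewrite mulr0n /expi cos0 sin0.
Qed.

Definition root_of_unity (R : realType) (n : nat) (g : 'Z_n) : R[i] :=
  expi (2 * (g : nat)%:R * pi / n%:R).

Lemma norm_root_of_unity (R : realType) (n : nat) (g : 'Z_n) :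
  `|root_of_unity R g| = 1.
Proof. exact: norm_expi. Qed.

Lemma cos_rotation_angle_ne1 (R : realType) (n : nat) (g : 'Z_n) : (2 <= n)%N ->
  g <> 1%g -> cos (2 * (g : nat)%:R * pi / n%:R) <> 1 :> R.
Proof.
move=> n2 g1; have g0 : (0 < g)%N.
  by rewrite lt0n; apply/eqP => g0; apply: g1; apply: val_inj.
have gn : (g < n)%N by rewrite -[X in (_ < X)%N](Zp_cast n2) ltn_ord.
have n0 : (0 : R) < n%:R by rewrite ltr0n (leq_trans _ n2).
pose b : R := g%:R * pi / n%:R.
have -> : 2 * (g : nat)%:R * pi / n%:R = b *+ 2.
  by rewrite -[RHS]mulr_natl /b !mulrA.
have : 0 < sin b.
  apply: sin_gt0_pi; rewrite divr_gt0 ?mulr_gt0 ?ltr0n ?pi_gt0 ?(ltnW n2) //=.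
  by rewrite ltr_pdivrMr // mulrC ltr_pM2l ?pi_gt0 // ltr_nat.
rewrite cos_mulr2n cos2sin2 => s0 E.
have : sin b ^+ 2 = 0 by lra.
by move/eqP; rewrite sqrf_eq0 gt_eqF.
Qed.

Lemma root_of_unity_ne1 (R : realType) (n : nat) (g : 'Z_n) : (2 <= n)%N ->
  g <> 1%g -> root_of_unity R g != 1.
Proof.
move=> n2 g1; apply/eqP => /(congr1 (@complex.Re R)) /=.
exact: cos_rotation_angle_ne1.
Qed.

Lemma root_of_unityE (R : realType) (n : nat) (g : 'Z_n) :
  root_of_unity R g = expi (pi *+ 2 / n%:R) ^+ g.
Proof.
rewrite -expiMn /root_of_unity; congr expi.
by rewrite -[RHS]mulr_natl -[pi *+ 2]mulr_natl mulrA [2 * _]mulrC mulrA.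
Qed.

(** The group law of ['Z_n] is addition of residues modulo [n], and the powers
    of [expi (2 * pi / n)] have period [n]. *)
Lemma root_of_unityM (R : realType) (n : nat) (g h : 'Z_n) : (2 <= n)%N ->
  root_of_unity R (g * h)%g = root_of_unity R g * root_of_unity R h.
Proof.
move=> n2; rewrite !root_of_unityE -exprD; apply: expr_mod.
rewrite Zp_cast // -expiMn -[_ *+ n]mulr_natr divfK; last first.
  by rewrite pnatr_eq0 -lt0n ltnW.
by rewrite /expi cos2pi sin2pi.
Qed.

Lemma root_of_unity1 (R : realType) (n : nat) :
  root_of_unity R (1%g : 'Z_n) = 1.
Proof. by rewrite root_of_unityE expr0. Qed.

Lemma root_of_unity_inj (R : realType) (n : nat) (g h : 'Z_n) : (2 <= n)%N ->
  root_of_unity R g = root_of_unity R h -> g = h.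
Proof.
move=> n2 gh; apply/eqP; rewrite eq_mulgV1; apply/negPn/negP => /eqP ne.
have /eqP[] := root_of_unity_ne1 R n2 ne.
by rewrite root_of_unityM // gh -root_of_unityM // mulgV root_of_unity1.
Qed.

Definition dist2 (R : realType) (x y : 'cV[R]_2) : R :=
  (x 0 0 - y 0 0) ^+ 2 + (x 1 0 - y 1 0) ^+ 2.

Lemma euclidean_norm_dist2 (R : realType) (x y : 'cV[R]_2) :
  euclidean_norm (x - y) = Num.sqrt (dist2 x y).
Proof.
rewrite /euclidean_norm big_ord_recl big_ord1 /dist2 !mxE.
by have -> : lift ord0 ord0 = 1 :> 'I_2 by exact: val_inj.
Qed.

Lemma dist2_ge0 (R : realType) (x y : 'cV[R]_2) : 0 <= dist2 x y.
Proof. by rewrite addr_ge0 ?sqr_ge0. Qed.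

Lemma euclidean_norm_eq (R : realType) (x y x' y' : 'cV[R]_2) :
  euclidean_norm (x - y) = euclidean_norm (x' - y') <-> dist2 x y = dist2 x' y'.
Proof.
rewrite !euclidean_norm_dist2; split=> [|->//].
by move/eqP; rewrite eqr_sqrt ?dist2_ge0 // => /eqP.
Qed.

Lemma dist2_continuous (R : realType) (V : finType) (P : R -> V -> 'cV[R]_2)
    (A : set R) (u v : V) :
  {within A, continuous (P : R -> {ptws V -> 'cV[R]_2})}%classic ->
  {within A, continuous (fun t => dist2 (P t u) (P t v))}%classic.
Proof.
move=> cP.
have cc (x : V) (i : 'I_2) : {within A, continuous (fun t => P t x i 0)}%classic.
  move=> t.
  apply: (@continuous_comp (subspace A) 'cV[R]_2 R (fun t => P t x)
      (fun M : 'cV[R]_2 => M i 0) t _ (@coord_continuous R 2 1 i 0 _)).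
  apply: (@continuous_comp (subspace A) {ptws V -> 'cV[R]_2} 'cV[R]_2 P
      (fun f : {ptws V -> 'cV[R]_2} => f x) t (cP t)).
  exact: (@proj_continuous V (fun=> 'cV[R]_2) x).
have cB (i : 'I_2) : {within A, continuous (fun t => P t u i 0 - P t v i 0)}%classic.
  by move=> t; apply: cvgB; apply: cc.
move=> t; apply: cvgD; rewrite expr2; apply: cvgM; exact: cB.
Qed.

Definition complex_coord (R : realType) (x : 'cV[R]_2) : R[i] :=
  (x 0 0 +i* x 1 0)%C.

Definition conj_coord (R : realType) (x : 'cV[R]_2) : R[i] :=
  (x 0 0 -i* x 1 0)%C.

Lemma mul_coord_dist2 (R : realType) (x y : 'cV[R]_2) :
  (complex_coord x - complex_coord y) * (conj_coord x - conj_coord y) =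
  (dist2 x y)%:C%C.
Proof.
by rewrite /complex_coord /conj_coord /dist2; simpc; congr (_ +i* _)%C; ring.
Qed.

Lemma tau_mulE (R : realType) (n : nat) (g : 'Z_n) (x : 'cV[R]_2) :
  complex_coord (tau R g *m x) = root_of_unity R g * complex_coord x.
Proof.
rewrite /complex_coord /root_of_unity !mxE !big_ord_recl !big_ord0 !mxE /=; simpc.
have -> : lift ord0 ord0 = 1 :> 'I_2 by exact: val_inj.
by rewrite [X in (_ +i* X)%C]addrC.
Qed.

Lemma tau_mul_conjE (R : realType) (n : nat) (g : 'Z_n) (x : 'cV[R]_2) :
  conj_coord (tau R g *m x) = (root_of_unity R g)^-1 * conj_coord x.
Proof.
rewrite invc_norm norm_root_of_unity expr1n invr1 mul1r.
have conjE (y : 'cV[R]_2) : conj_coord y = ((complex_coord y)^*)%C by [].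
by rewrite !conjE tau_mulE -rmorphM.
Qed.

Lemma dist2_eq0 (R : realType) (x y : 'cV[R]_2) : dist2 x y = 0 -> x = y.
Proof.
move/eqP; rewrite paddr_eq0 ?sqr_ge0 // !sqrf_eq0 !subr_eq0.
case/andP=> /eqP x0 /eqP x1.
apply/colP => i; case: i => [[|[|//]] lt].
  by have -> : Ordinal lt = 0 by exact: val_inj.
by have -> : Ordinal lt = 1 by exact: val_inj.
Qed.

Definition plane_point (R : realType) (z : R[i]) : 'cV[R]_2 :=
  \col_i (if i == 0 then complex.Re z else complex.Im z).

Lemma plane_pointK (R : realType) : cancel (@plane_point R) (@complex_coord R).
Proof. by case=> x y; rewrite /complex_coord !mxE. Qed.

Lemma complex_coord_inj (R : realType) : injective (@complex_coord R).
Proof.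
move=> x y [x0 x1]; apply: dist2_eq0.
by rewrite /dist2 x0 x1 !subrr expr0n addr0.
Qed.

Lemma dist2_norm (R : realType) (x y : 'cV[R]_2) :
  (dist2 x y)%:C%C = `|complex_coord x - complex_coord y| ^+ 2.
Proof. by rewrite sqr_normc rmorphB -mul_coord_dist2. Qed.

Lemma dist2_plane_point (R : realType) (z w z' w' : R[i]) :
  dist2 (plane_point z) (plane_point w) =
    dist2 (plane_point z') (plane_point w') <->
  `|z - w| = `|z' - w'|.
Proof.
split=> [E|E].
  have := congr1 (real_complex R) E; rewrite !dist2_norm !plane_pointK => /eqP.
  by rewrite eqrXn2 // => /eqP.
by apply: (@complexI R); rewrite !dist2_norm !plane_pointK E.
Qed.

(** * From a flex to a colouring *)

(** Every value between [f a] and [f t] is attained, by the intermediate value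
    theorem. *)
Lemma nonconstant_continuous_infinite (R : realType) (f : R -> R) (a b t : R) :
  {within `[a, b], continuous f}%classic -> a <= t <= b -> f t != f a ->
  forall s : seq R, exists2 x, a <= x <= b & f x \notin s.
Proof.
move=> cf /andP[at_ tb] ne s.
pose val k : R := f a + (f t - f a) * k.+1%:R^-1.
have val_inj : injective val.
  move=> k l /addrI /mulfI; rewrite subr_eq0 => /(_ ne) /invr_inj /eqP.
  by rewrite eqr_nat => /eqP[].
pose r := [seq val k | k <- iota 0 (size s).+1].
have ur : uniq r by rewrite map_inj_uniq ?iota_uniq.
have [y yr ys] : exists2 y, y \in r & y \notin s.
  apply/hasP; rewrite has_predC; apply/negP => /allP rs.
  by have := uniq_leq_size ur rs; rewrite size_map size_iota ltnn.
have [k _ yE] := mapP yr.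
have ct : {within `[a, t], continuous f}%classic.
  apply: continuous_subspaceW cf => x /=; rewrite !in_itv /= => /andP[-> /=].
  by move=> xt; apply: le_trans tb.
have [x] : exists2 x, x \in `[a, t] & f x = y.
  apply: IVT => //; rewrite yE /val.
  have k0 : 0 <= (k.+1%:R^-1 : R) by rewrite invr_ge0 ler0n.
  have k1 : (k.+1%:R^-1 : R) <= 1 by rewrite invf_le1 ?ltr0n // ler1n.
  move: (k.+1%:R^-1) k0 k1 => c c0 c1.
  by case: (leP (f a) (f t)) => fat /=; apply/andP; split; nra.
rewrite in_itv /= => /andP[ax xt] fx; exists x; last by rewrite fx.
by rewrite ax (le_trans xt).
Qed.

Lemma nonzero_family_bounded_below (C : numFieldType) (I : finType) (x : I -> C)
    (A : {pred I}) :
  (forall i, i \in A -> x i != 0) ->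
  exists2 B : C, 1 <= B & forall i, i \in A -> 1 <= B * `|x i|.
Proof.
move=> x0; pose S := \sum_i `|x i|^-1.
have S0 : 0 <= S by apply: sumr_ge0 => i _; rewrite invr_ge0.
exists (1 + S) => [|i /x0 xi]; first by rewrite lerDl.
have n0 : 0 < `|x i| by rewrite normr_gt0.
rewrite -ler_pdivrMr // mul1r ler_wpDl //.
rewrite /S (bigD1 i) //= lerDl; apply: sumr_ge0 => j _; by rewrite invr_ge0.
Qed.

Lemma family_bounded (C : numDomainType) (I : finType) (x : I -> C) :
  exists2 B : C, 1 <= B & forall i, `|x i| <= B.
Proof.
have S0 : 0 <= \sum_i `|x i| by apply: sumr_ge0.
exists (1 + \sum_i `|x i|) => [|i]; first by rewrite lerDl.
by rewrite ler_wpDl // (bigD1 i) //= lerDl; apply: sumr_ge0.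
Qed.

Lemma flexible_symmetric_NAC_colouring (R : realType) (V : finType)
    (e : rel V) (n : nat) (theta : {morphism [set: 'Z_n]%SET >-> {perm V}})
    (p : V -> 'cV[R]_2) :
  (2 <= n)%N -> simple_graph e -> connected_graph e ->
  (forall g : 'Z_n, theta g \in graph_aut e) ->
  placement e p -> symmetric_flexible e theta p ->
  exists delta : {set V} -> bool, symmetric_NAC_colouring e delta theta.
Proof.
move=> n2 [e_sym e_irr] conn aut p_inj [P [[cP P0 Peq] nontriv Psym]].
(* A pair [u], [v] whose distance changes along the flex yields a colouring. *)
apply: contrapT => nodelta; apply: nontriv => t t01 u v.
apply/euclidean_norm_eq; apply: contrapT => ne; apply: nodelta.
have theta_aut g x y : e (theta g x) (theta g y) = e x y.
  by have := aut g; rewrite inE => /forallP/(_ x)/forallP/(_ y)/eqP.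
pose len2 x y : R[i] := (dist2 (p x) (p y))%:C%C.
have [|B B1 chi_far'] := @nonzero_family_bounded_below R[i] _
  (fun g : 'Z_n => 1 - root_of_unity R g) [pred g | g != 1%g] _.
  by move=> g g1; rewrite subr_eq0 eq_sym root_of_unity_ne1 //; apply/eqP.
have chi_far (g : 'Z_n) : g <> 1%g -> 1 <= B * `|1 - root_of_unity R g|.
  by move/eqP; exact: chi_far'.
have [|L1 L11 len_ge] := @nonzero_family_bounded_below R[i] _
  (fun xy : V * V => len2 xy.1 xy.2) [pred xy | e xy.1 xy.2] _.
  move=> [x y] /= exy; apply/eqP => /(congr1 (@complex.Re R)) /= /dist2_eq0.
  exact: p_inj.
have [L2 L21 len_le] := @family_bounded R[i] _
  (fun xy : V * V => len2 xy.1 xy.2).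
have cfgP (s : R) : 0 <= s <= 1 -> complex_configuration e (fun g => theta g)
    (@root_of_unity R n) len2 (fun x => complex_coord (P s x))
    (fun x => conj_coord (P s x)).
  move=> s01; split=> [x y exy|g x].
    rewrite mul_coord_dist2; congr (_%:C)%C.
    by have [_ /(_ x y exy)/euclidean_norm_eq] := Peq s s01.
  by rewrite (Psym s s01) tau_mulE tau_mul_conjE.
have inf (s : seq R[i]) : exists z w,
   complex_configuration e (fun g => theta g) (@root_of_unity R n) len2 z w /\
   (z u - z v) * (w u - w v) \notin s.
  have cd := dist2_continuous (u := u) (v := v) cP.
  have ne0 : dist2 (P t u) (P t v) != dist2 (P 0 u) (P 0 v).
    by rewrite P0; apply/eqP.
  have [x x01 xs] := nonconstant_continuous_infinite cd t01 ne0
    [seq complex.Re c | c <- s].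
  exists (fun y => complex_coord (P x y)), (fun y => conj_coord (P x y)).
  split; first exact: cfgP.
  rewrite mul_coord_dist2; apply: contra xs => xs.
  by apply/mapP; eexists; [exact: xs|].
pose L := L1 * L2.
have L1L : L1 <= L by rewrite ler_peMr // (le_trans ler01).
have L2L : L2 <= L by rewrite ler_peMl // (le_trans ler01).
pose K := (L * (gap_ratio V B L ^+ #|{: V * V}|.+1) ^+ 2) *+ #|V| *+ #|V|.
have K0 : 0 <= K.
  have L_ge1 : 1 <= L := le_trans L11 L1L.
  have G0 := le_trans ler01 (gap_ratio_ge1 V B1 L_ge1).
  do 2 apply: mulrn_wge0; apply: mulr_ge0; first exact: le_trans L_ge1.
  by do 2 apply: exprn_ge0.
have [|z [w [cfg big]]] := complex_configuration_unbounded inf (_ : 0 <= K + 1).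
  by rewrite addr_ge0.
apply: (large_configuration_NAC_colouring e_sym e_irr theta_aut
  (@norm_root_of_unity R n) B1 (le_trans L11 L1L) chi_far _ _ (conn u v) cfg).
- by move=> x y exy; apply: le_trans (len_le (x, y)) L2L.
- move=> x y exy; apply: le_trans (len_ge (x, y) exy) _.
  by rewrite ler_wpM2r.
by apply: lt_le_trans big; rewrite ltrDl.
Qed.

(** * From a colouring to a flex *)

(** Equivariance forces [a] to vanish on every [x] fixed by some [g != 1], so no
    more injectivity can be expected. The map sums a weight [c] over the group,
    twisted by the roots of unity: [c] is supported on the first element of
    each orbit, so on a free orbit exactly one term survives, and the absolute
    value of [a] tells the free orbits apart. *)
Lemma equivariant_separating_map (R : realType) (n : nat) (T : finType)
    (act : 'Z_n -> T -> T) :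
  (2 <= n)%N -> (forall x, act 1%g x = x) ->
  (forall g h x, act (g * h)%g x = act h (act g x)) ->
  exists a : T -> R[i],
    (forall g x, a (act g x) = root_of_unity R g * a x) /\
    (forall x y, a x = a y -> x = y \/
      (exists g, g <> 1%g /\ act g x = x) /\
      (exists g, g <> 1%g /\ act g y = y)).
Proof.
move=> n2 act1 actM.
pose minimal x := [forall g, enum_rank x <= enum_rank (act g x)]%N.
pose c x : R[i] := if minimal x then (enum_rank x).+1%:R else 0.
pose a x : R[i] := \sum_g c (act g^-1%g x) * root_of_unity R g.
have a_act g x : a (act g x) = root_of_unity R g * a x.
  rewrite /a (reindex_inj (mulIg g)) mulr_sumr; apply: eq_bigr => k _ /=.
  by rewrite -actM invMg mulKVg root_of_unityM // mulrA [LHS]mulrC.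
pose fixed x := exists g, g <> 1%g /\ act g x = x.
have a_fixed x : fixed x -> a x = 0.
  case=> g [g1 gx]; have := a_act g x; rewrite gx => /eqP.
  rewrite -subr_eq0 -[X in X - _]mul1r -mulrBl mulf_eq0 subr_eq0 eq_sym.
  by rewrite (negPf (root_of_unity_ne1 R n2 g1)) => /eqP.
have a_free x : ~ fixed x ->
    exists g y, x = act g y /\ a x = (enum_rank y).+1%:R * root_of_unity R g.
  move=> free; case: (arg_minnP (fun g => enum_rank (act g x) : nat)
    (isT : xpredT (1%g : 'Z_n))).
  move=> g _ gmin; exists g^-1%g, (act g x).
  split; first by rewrite -actM mulgV act1.
  have minK k : minimal (act k^-1%g x) = (k == g^-1%g).
    apply/forallP/eqP => [kmin|-> h]; last by rewrite invgK -actM gmin.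
    have xk : act k^-1%g x = act g x.
      apply: enum_rank_inj; apply: val_inj; apply/eqP.
      rewrite eqn_leq gmin // andbT.
      by have := kmin (k * g)%g; rewrite -actM mulKg.
    have kg : (k^-1 * g^-1)%g = 1%g.
      apply: contrapT => ne; apply: free; exists (k^-1 * g^-1)%g; split=> //.
      by rewrite actM xk -actM mulgV act1.
    have /eqP <- : (k^-1 == g)%g by rewrite eq_mulgV1 kg.
    by rewrite invgK.
  rewrite /a (bigD1 g^-1%g) //= big1 ?addr0 => [|k kg].
    by rewrite /c minK eqxx invgK.
  by rewrite /c minK (negPf kg) mul0r.
have rank_norm k (g : 'Z_n) : `|k.+1%:R * root_of_unity R g| = k.+1%:R.
  by rewrite normrM norm_root_of_unity mulr1 normr_nat.
have rank_ne0 k (g : 'Z_n) : k.+1%:R * root_of_unity R g <> 0.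
  by move/eqP; rewrite -normr_eq0 rank_norm pnatr_eq0.
exists a; split=> // x y axy.
have [fx|nfx] := pselect (fixed x); have [fy|nfy] := pselect (fixed y).
- by right.
- have [g [z [_ ay]]] := a_free y nfy; case: (rank_ne0 (enum_rank z) g).
  by rewrite -ay -axy a_fixed.
- have [g [z [_ ax]]] := a_free x nfx; case: (rank_ne0 (enum_rank z) g).
  by rewrite -ax axy a_fixed.
- left; have [g [z [xE ax]]] := a_free x nfx.
  have [h [t [yE ay]]] := a_free y nfy.
  have tz : t = z.
    move: (congr1 Num.norm axy); rewrite ax ay !rank_norm => /eqP.
    by rewrite eqr_nat => /eqP[] /val_inj/enum_rank_inj.
  move: axy; rewrite ax ay tz => /mulfI; rewrite pnatr_eq0 => /(_ isT).
  by move=> /(root_of_unity_inj n2) gh; rewrite xE yE gh tz.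
Qed.

Lemma continuous_ptws (S : topologicalType) (I : Type) (T : topologicalType)
    (F : S -> I -> T) :
  (forall i, continuous (fun s => F s i)) ->
  continuous (F : S -> {ptws I -> T}).
Proof.
move=> cF s; apply/cvg_sup => i; move: s.
apply/(@continuousP _ (initial_topology (fun f : I -> T => f i))).
move=> A [B oB <-].
by move/continuousP: (cF i); apply.
Qed.

Lemma plane_point_rotation_continuous (R : realType) (a b : R[i]) :
  continuous (fun t : R => plane_point (a + expi t * b)).
Proof.
have -> : (fun t : R => plane_point (a + expi t * b)) =
    (fun t => plane_point a + cos t *: plane_point b +
              sin t *: plane_point ('i%C * b)).
  apply/funext => t; apply/colP => i; rewrite !mxE.
  case: a b => [a1 a2] [b1 b2]; rewrite /expi; simpc => /=.
  by case: ifP => _; ring.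
move=> t; apply: cvgD; last first.
  by apply: cvgZr_tmp; apply: continuous_sin.
apply: cvgD; first exact: cvg_cst.
by apply: cvgZr_tmp; apply: continuous_cos.
Qed.

(** [`|a + expi t * b| ^+ 2] is a constant plus twice [c1 * cos t + c2 * sin t],
    where [c1] and [c2] are the real and imaginary parts of [a * b^*]. Equality
    of the values at [0], [1 / 2] and [1] forces [c1 = c2 = 0]. *)
Lemma rotating_norm_nonconstant (R : realType) (a b : R[i]) :
  a != 0 -> b != 0 ->
  exists2 t : R, 0 <= t <= 1 & `|a + expi t * b| <> `|a + expi 0 * b|.
Proof.
move=> a0 b0; apply: contrapT => const.
have {}const (t : R) : 0 <= t <= 1 -> `|a + expi t * b| = `|a + expi 0 * b|.
  by move=> t01; apply: contrapT => ne; apply: const; exists t.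
case: a b a0 b0 const => [a1 a2] [b1 b2] a0 b0 const.
pose c1 := a1 * b1 + a2 * b2; pose c2 := a2 * b1 - a1 * b2.
have c12 t : 0 <= t <= 1 -> cos t * c1 + sin t * c2 = c1.
  move=> /const /(congr1 (fun x => x ^+ 2)); rewrite -!add_Re2_Im2 /expi.
  move/complexI; simpc => /=; rewrite cos0 sin0 => E.
  have := cos2Dsin2 t; rewrite /c1 /c2; move: (cos t) (sin t) E => C S E CS.
  nra.
have s0 : 0 < sin (2^-1 : R).
  apply: sin_gt0_pi; have := pi_ge2 R; lra.
have h1 : cos (2^-1 : R) * c1 + sin (2^-1) * c2 = c1 by apply: c12; lra.
have h2 := c12 1 _.
have two : (1 : R) = 2^-1 *+ 2 by lra.
have cs := cos2Dsin2 (2^-1 : R).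
have {}h2 : (cos (2^-1 : R) ^+2 *+ 2 - 1) * c1 +
    (cos 2^-1 * sin 2^-1) *+ 2 * c2 = c1.
  by rewrite -cos_mulr2n -sin_mulr2n -two; apply: h2; lra.
move: (sin _) (cos _) s0 h1 h2 cs => S C s0 h1 h2 cs.
have c10 : c1 = 0.
  have : (1 - C) * c1 = 0.
    have h3 : C * (S * c2) = C * ((1 - C) * c1) by congr (_ * _); lra.
    lra.
  move/eqP; rewrite mulf_eq0 => /orP[/eqP C1|/eqP //].
  have : S ^+ 2 = 0 by rewrite -[C](subKr 1) C1 in cs; lra.
  by move/eqP; rewrite sqrf_eq0 gt_eqF.
have c20 : c2 = 0.
  move: h1; rewrite c10 mulr0 add0r => /eqP.
  by rewrite mulf_eq0 gt_eqF //= => /eqP.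
have : (a1 ^+ 2 + a2 ^+ 2) * (b1 ^+ 2 + b2 ^+ 2) = c1 ^+ 2 + c2 ^+ 2.
  by rewrite /c1 /c2; ring.
rewrite c10 c20 expr0n addr0 => /eqP; rewrite mulf_eq0 !paddr_eq0 ?sqr_ge0 //.
rewrite !sqrf_eq0 => /orP[]/andP[/eqP x0 /eqP y0].
  by case/eqP: a0; rewrite x0 y0.
by case/eqP: b0; rewrite x0 y0.
Qed.

(** Otherwise the vertices on red edges would be closed under adjacency, and no
    blue edge could exist in a connected graph. *)
Lemma bicoloured_vertex (V : finType) (e : rel V) (delta : {set V} -> bool) :
  symmetric e -> connected_graph e ->
  (forall col : bool, exists u v, e u v /\ delta [set u; v]%SET = col) ->
  exists w u v, mono_adj e delta red w u /\ mono_adj e delta blue w v.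
Proof.
move=> e_sym conn surj; apply: contrapT => none.
pose S : {pred V} := [pred x | [exists y, mono_adj e delta red x y]].
have S_red x y : x \in S -> e x y -> mono_adj e delta red x y.
  move=> /existsP[u xu] exy; rewrite /mono_adj /= exy /=.
  apply: contrapT => ncol; apply: none; exists x, u, y; split=> //.
  by rewrite /mono_adj /= exy /=; move: ncol; case: (delta _).
have S_closed : fingraph.closed e S.
  apply: intro_closed; first exact: sym_connect_sym.
  move=> x y exy xS; apply/existsP; exists x.
  by rewrite (mono_adj_sym _ _ e_sym) S_red.
have [r1 [r2 [er rcol]]] := surj red; have [b1 [b2 [eb bcol]]] := surj blue.
have r1S : r1 \in S by apply/existsP; exists r2; rewrite /mono_adj /= er rcol.
have b1S : b1 \in S by rewrite -(closed_connect S_closed (conn r1 b1)).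
by have /andP[_] := S_red _ _ b1S eb; rewrite bcol.
Qed.

Definition component_of (V : finType) (e : rel V) (delta : {set V} -> bool)
    (col : bool) (v : V) : {set V} :=
  [set w | connect (mono_adj e delta col) v w]%SET.

Lemma component_of_in (V : finType) (e : rel V) (delta : {set V} -> bool)
    col v :
  component_of e delta col v \in mono_components e delta col.
Proof. exact: imset_f. Qed.

Lemma component_of_eq (V : finType) (e : rel V) (delta : {set V} -> bool)
    col u v :
  symmetric e ->
  (component_of e delta col u = component_of e delta col v) <->
  connect (mono_adj e delta col) u v.
Proof.
move=> e_sym; have csym := sym_connect_sym (mono_adj_sym delta col e_sym).
split=> [E|uv]; last first.
  by apply/finset.setP => x; rewrite !inE (same_connect csym uv).
have : v \in component_of e delta col u by rewrite E inE.
by rewrite inE.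
Qed.

Lemma connect_homo (V : finType) (r : rel V) (s : V -> V) (u v : V) :
  (forall x y, r x y -> r (s x) (s y)) -> connect r u v ->
  connect r (s u) (s v).
Proof.
move=> hom /connectP[p pp ->]; elim: p u pp => //= x p IH u /andP[/hom ux /IH].
exact/connect_trans/connect1.
Qed.

Lemma component_of_act (V : finType) (e : rel V) (delta : {set V} -> bool) col
    (s : {perm V}) v :
  (forall x y, mono_adj e delta col (s x) (s y) = mono_adj e delta col x y) ->
  (s @: component_of e delta col v)%SET = component_of e delta col (s v).
Proof.
move=> inv; apply/finset.setP => x; apply/imsetP/idP => [[y]|].
  by rewrite !inE => vy ->; apply: connect_homo vy => a b; rewrite inv.
rewrite inE => vx; exists ((s^-1)%g x); last by rewrite permKV.
rewrite inE -[v](permK s); apply: connect_homo vx => a b.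
by rewrite -{1}[a](permKV s) -{1}[b](permKV s) inv.
Qed.

(** The ends of a red edge lie in one red component but, by the condition on
    cycles, in two blue components; these are not both partially invariant, so
    [a] separates them and the edge does not collapse. Likewise for blue. *)
Lemma symmetric_NAC_colouring_flexible (R : realType) (V : finType) (e : rel V)
    (n : nat) (theta : {morphism [set: 'Z_n]%SET >-> {perm V}}) delta :
  (2 <= n)%N -> simple_graph e -> connected_graph e ->
  (forall g : 'Z_n, theta g \in graph_aut e) ->
  symmetric_NAC_colouring e delta theta ->
  exists p : V -> 'cV[R]_2,
    [/\ placement e p, symmetric_placement theta p
      & symmetric_flexible e theta p].
Proof.
move=> n2 [e_sym e_irr] conn aut [[surj nac] delta_inv apart].
have theta_aut g x y : e (theta g x) (theta g y) = e x y.
  by have := aut g; rewrite inE => /forallP/(_ x)/forallP/(_ y)/eqP.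
have mono_inv col g x y :
    mono_adj e delta col (theta g x) (theta g y) = mono_adj e delta col x y.
  rewrite /mono_adj /= theta_aut; case exy: (e x y) => //=.
  by rewrite delta_inv.
pose act (g : 'Z_n) (H : {set V}) : {set V} := (theta g @: H)%SET.
have act1 H : act 1%g H = H.
  by rewrite /act morph1 -[RHS]imset_id; apply: eq_imset => x; rewrite perm1.
have actM g h H : act (g * h)%g H = act h (act g H).
  rewrite /act morphM ?finset.inE // -imset_comp; apply: eq_imset => x.
  by rewrite permM.
have [a [a_act a_inj]] := equivariant_separating_map R n2 act1 actM.
pose comp := component_of e delta.
have a_comp col u v : e u v -> delta [set u; v]%SET <> col ->
    a (comp col u) <> a (comp col v).
  move=> euv ncol /a_inj[/component_of_eq uv|[pu pv]].
    apply: ncol; apply: (NAC_cycles_mono_connect e_sym e_irr nac euv).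
    exact: uv.
  have [/component_of_eq uv|ne] := pselect (comp col u = comp col v).
    apply: ncol; apply: (NAC_cycles_mono_connect e_sym e_irr nac euv).
    exact: uv.
  have := apart col _ _ (component_of_in _ _ _ u) (component_of_in _ _ _ v)
    pu pv ne u v.
  by rewrite !inE !connect0 euv => /(_ isT isT).
have a_same col u v : e u v -> delta [set u; v]%SET = col ->
    a (comp col u) = a (comp col v).
  move=> euv ucol; congr a; apply/component_of_eq => //.
  by apply: connect1; rewrite /mono_adj /= euv ucol eqxx.
pose z t v := a (comp red v) + expi t * a (comp blue v).
have zB t u v : z t u - z t v = (a (comp red u) - a (comp red v)) +
    expi t * (a (comp blue u) - a (comp blue v)).
  by rewrite /z mulrBr opprD addrACA.
pose P (t : R) v : 'cV[R]_2 := plane_point (z t v).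
have red_diff t u v : e u v -> delta [set u; v]%SET = red ->
    z t u - z t v = expi t * (a (comp blue u) - a (comp blue v)).
  by move=> euv c; rewrite zB (a_same red u v) // subrr add0r.
have blue_diff t u v : e u v -> delta [set u; v]%SET = blue ->
    z t u - z t v = a (comp red u) - a (comp red v).
  by move=> euv c; rewrite zB (a_same blue u v) // subrr mulr0 addr0.
have P_placement t : placement e (P t).
  move=> u v euv /(congr1 (@complex_coord R)); rewrite !plane_pointK => /eqP.
  rewrite -subr_eq0; case c: (delta [set u; v]%SET).
    rewrite red_diff // mulf_eq0 -normr_eq0 norm_expi oner_eq0 /= subr_eq0.
    by move/eqP; apply: a_comp; rewrite // c.
  by rewrite blue_diff // subr_eq0 => /eqP; apply: a_comp; rewrite // c.
have P_equiv t : equivalent_frameworks e (P t) (P 0).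
  move=> u v euv; apply/euclidean_norm_eq/dist2_plane_point.
  case c: (delta [set u; v]%SET); last by rewrite !blue_diff.
  by rewrite !red_diff // !normrM !norm_expi.
have P_sym t : symmetric_placement theta (P t).
  move=> g v; apply: complex_coord_inj; rewrite tau_mulE !plane_pointK /z.
  have compE col : comp col (theta g v) = act g (comp col v).
    by rewrite /act component_of_act.
  by rewrite !compE !a_act mulrDr [expi t * _]mulrCA.
exists (P 0); split => //; exists P; split.
- split=> //.
  apply/continuous_subspaceT/continuous_ptws => v.
  exact: plane_point_rotation_continuous.
- move=> triv; have [w [u [v [/andP[ewu /eqP wu] /andP[ewv /eqP wv]]]]] :=
    bicoloured_vertex e_sym conn surj.
  have r0 : a (comp red u) - a (comp red v) != 0.
    rewrite subr_eq0 -(a_same red w u) //; apply/eqP; apply: a_comp => //.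
    by rewrite wv.
  have b0 : a (comp blue u) - a (comp blue v) != 0.
    rewrite subr_eq0 -(a_same blue w v) // eq_sym.
    apply/eqP; apply: a_comp => //.
    by rewrite wu.
  have [t t01] := rotating_norm_nonconstant r0 b0; rewrite -!zB; apply.
  by apply/dist2_plane_point/euclidean_norm_eq; apply: triv.
- by [].
Qed.

Theorem theorem1 (R : realType) (V : finType) (e : rel V) (n : nat)
    (theta : {morphism [set: 'Z_n]%SET >-> {perm V}})
    (n_ge2 : (2 <= n)%N)
    (G_simple : simple_graph e)
    (G_connected : connected_graph e)
    (G_symmetric : symmetric_graph e theta) :
  (exists delta : {set V} -> bool, symmetric_NAC_colouring e delta theta) <->
  (exists p : V -> 'cV[R]_2,
    [/\ placement e p, symmetric_placement theta p
      & symmetric_flexible e theta p]).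
Proof.
have [[_ aut] _ _] := G_symmetric; split=> [[delta nac]|[p [p_inj _ p_flex]]].
  exact: symmetric_NAC_colouring_flexible nac.
exact: flexible_symmetric_NAC_colouring p_flex.
Qed.
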